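(* Let $\mathcal{H}$ be a separable Hilbert space, $K\in B(\mathcal{H})$, and let $F=\{f_i\}_{i\in I}$ be a Parseval $K$-frame for $\mathcal{H}$. Then for every subset $J$ of $I$ and every $f\in\mathcal{H}$, $$\frac12\Vert KK^*f\Vert^2\le\left\Vert\sum_{i\in J}\langle f,f_i\rangle f_i\right\Vert^2+\left\Vert\sum_{i\in J^c}\langle f,f_i\rangle f_i\right\Vert^2\le 2\Vert K\Vert^2\Vert K^*f\Vert^2-\frac12\Vert KK^*f\Vert^2 .$$
   Context: $B(\mathcal{H})$ is the set of bounded linear operators on $\mathcal{H}$, $I$ is a countable index set, and $J^c=I\setminus J$. A sequence $\{f_i\}_{i\in I}\subseteq\mathcal{H}$ is a Parseval $K$-frame for $\mathcal{H}$ if $\sum_{i\in I}|\langle f,f_i\rangle|^2=\Vert K^*f\Vert^2$ for all $f\in\mathcal{H}$. *)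

(* Defs.v *)
From HB Require Import structures.
From mathcomp Require Import all_boot all_order all_algebra.
From mathcomp Require Import complex.
From mathcomp Require Import all_classical all_reals all_analysis.
From mathcomp Require Import summability.

Set Implicit Arguments.
Unset Strict Implicit.
Unset Printing Implicit Defensive.
Import Order.TTheory GRing.Theory Num.Theory.
Import numFieldNormedType.Exports.

Local Open Scope classical_set_scope.
Local Open Scope ring_scope.

(* Hilbert spaces may be real or complex: [scalar_field R k] is R or R[i], and
   [scalar_conj R k] is the corresponding conjugation (trivial on R). *)
Variant scalar_kind := RealScalars | ComplexScalars.

Definition scalar_field (R : realType) (k : scalar_kind) : numFieldType :=
  match k with RealScalars => R | ComplexScalars => R[i]%C end.

Definition scalar_conj (R : realType) (k : scalar_kind) :
    {rmorphism scalar_field R k -> scalar_field R k} :=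
  match k return {rmorphism scalar_field R k -> scalar_field R k} with
  | RealScalars => idfun
  | ComplexScalars => @Num.conj R[i]%C
  end.
Arguments scalar_conj R k : clear implicits.

Section Operators.
Variables (C : numFieldType) (H : normedModType C).

Definition separable_space := exists2 D : set H, countable D & dense D.

Definition bounded_operator (T : H -> H) :=
  exists M : C, forall x, `|T x| <= M * `|x|.

(* The norm of H takes its values among the nonnegative reals of C, and the
   order of C restricts to the usual one there; hence [supremum] (the least
   upper bound for that partial order) is the supremum of real numbers. *)
Definition op_norm (T : H -> H) : C :=
  supremum 0 [set `|T x| | x in [set x : H | `|x| <= 1]].

(* [adjoint ip T y] is the vector z, unique by nondegeneracy of ip and given
   by the Riesz theorem when T is bounded, such that <T x, y> = <x, z> for
   all x. *)
Definition adjoint (ip : H -> H -> C) (T : H -> H) (y : H) : H :=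
  xget 0 [set z | forall x, ip (T x) y = ip x z].

End Operators.

Section Sums.
Variables (I : choiceType) (C : numFieldType) (V : normedModType C).

(* Sums over index sets are unordered: limits of the finite partial sums along
   the directed set of finite subsets of I. *)
Definition summable_on (J : set I) (x : I -> V) :=
  cvg (partial_sum (patch (fun=> 0) J x) @ totally).

Definition sum_on (J : set I) (x : I -> V) : V :=
  summability.sum (patch (fun=> 0) J x).

End Sums.

Definition parseval_Kframe (C : numFieldType) (H : normedModType C)
    (ip : H -> H -> C) (K : H -> H) (I : choiceType) (F : I -> H) :=
  forall f : H,
    partial_sum (fun i => `|ip f (F i)| ^+ 2) @ totally
      --> (`|adjoint ip K f| ^+ 2 : C).

(* Main.v *)
Require Import Defs.
From mathcomp Require Import all_boot all_order all_algebra.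
From mathcomp Require Import finmap complex ring.
From mathcomp Require Import all_classical all_reals all_analysis.
From mathcomp Require Import summability.
Set Implicit Arguments.
Unset Strict Implicit.
Unset Printing Implicit Defensive.
Import Order.TTheory GRing.Theory Num.Theory.
Import numFieldNormedType.Exports.
Local Open Scope classical_set_scope.
Local Open Scope ring_scope.

(** Write K^* for the adjoint, N for the operator norm of K, c_i = <f, f_i>, and
a, b for the two partial sums over J and its complement.

The frame identity gives the Bessel bound sum |<v, f_i>|^2 <= N^2 |v|^2, since
|K^* v| <= N |v|. Dualizing it, every finite synthesis v = sum c_i f_i obeys
|v|^2 <= N^2 sum |c_i|^2 ([synthesis_le]): expand |v|^2 = sum c_i <f_i, v> and
use Cauchy-Schwarz on the finite sum. As sum |c_i|^2 converges, the finite sums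
of c_i f_i over any index set are then Cauchy ([synthesis_cvg]), so a and b
exist, and adding the bounds over J and its complement gives
|a|^2 + |b|^2 <= N^2 |K^* f|^2 ([sum_on_sqr_le]). Moreover a + b = K K^* f
([frame_reconstruction]): the frame identity says that the frame operator and
K K^* have the same quadratic form, and polarization recovers the operator.

The lower bound is the parallelogram law, |a + b|^2 <= 2 (|a|^2 + |b|^2). The
upper bound follows from the bound on |a|^2 + |b|^2, because
|K K^* f|^2 <= N^2 |K^* f|^2 makes the right-hand side at least
(3/2) N^2 |K^* f|^2.

The adjoint picks a vector satisfying the adjunction identity; that there is one
is the Riesz representation theorem ([riesz]).
Real and complex scalars are treated at once: the argument uses only a field C
with an involutive automorphism theta such that z * theta z = |z|^2, in which
bounded nonempty sets of reals have suprema. The order of C is partial, so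
inequalities of norms are compared through squares and pass to limits by
[lim_le_cst]. *)

(** * Scalars *)

(** The form of order completeness that R and R[i] share; upper bounds range
over all of C, and they are automatically real. *)
Definition real_sup_complete (C : numFieldType) :=
  forall A : set C, A !=set0 -> A `<=` [set z | z \is Num.real] ->
    (exists b, ubound A b) -> exists s, supremums A s.

Lemma scalar_field_real_sup (R : realType) (k : scalar_kind) :
  real_sup_complete (scalar_field R k).
Proof.
case: k => /= A [a Aa] Areal [b Ab].
  have supA : has_sup A by split; [exists a|exists b].
  exists (sup A); split; first exact: sup_upper_bound.
  by move=> y Ay; exact: (ge_sup (ex_intro _ a Aa)).
(* The order of R[i] compares only numbers with equal imaginary parts. *)
have Im0 (z : R[i]) : A z -> complex.Im z = 0.
  move=> /Areal /=; rewrite realE !lecE /= => /orP[]/andP[/eqP] //.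
have supB : has_sup (@complex.Re R @` A).
  split; first by exists (complex.Re a), a.
  exists (complex.Re b) => _ [z Az <-].
  by have := Ab _ Az; rewrite lecE => /andP[].
exists (real_complex R (sup (@complex.Re R @` A))); split.
  move=> z Az; rewrite lecE /= Im0 // eqxx /=.
  by apply: sup_upper_bound => //; exists z.
move=> y Ay; rewrite lecE /=.
have := Ay _ Aa; rewrite lecE (Im0 _ Aa) => /andP[-> _] /=.
apply: (ge_sup supB.1).
by move=> _ [z Az <-]; have := Ay _ Az; rewrite lecE => /andP[].
Qed.

Lemma scalar_conjK (R : realType) (k : scalar_kind) :
  involutive (scalar_conj R k).
Proof. by case: k => //= z; rewrite conjCK. Qed.

Lemma mul_scalar_conj (R : realType) (k : scalar_kind) (z : scalar_field R k) :
  z * scalar_conj R k z = `|z| ^+ 2.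
Proof.
case: k z => /= z; last by rewrite normCK.
by rewrite real_normK ?num_real // expr2.
Qed.

Section LimitInequality.
Variables (C : numFieldType) (T : Type) (F : set_system T).
Context {FF : ProperFilter F}.

(** The order of C need not be total, so closedness of the nonnegative cone is
obtained from the norm: nonnegative numbers are the fixed points of |.|, and
fixed points of a continuous map are stable under limits. *)
Lemma lim_le_cst (u : T -> C) (l c : C) :
  u @ F --> l -> (\forall t \near F, u t <= c) -> l <= c.
Proof.
move=> ul uc.
have dl : (fun t => c - u t) @ F --> c - l.
  exact: (@cvgB C C T F _ (fun=> c) u c l (cvg_cst c) ul).
have dn : (fun t => c - u t) @ F --> `|c - l|.
  apply: (cvg_trans _ (cvg_norm dl)); apply: near_eq_cvg.
  by near=> t; rewrite /= ger0_norm // subr_ge0; near: t.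
rewrite -subr_ge0; have -> : c - l = `|c - l|.
  exact: (cvg_unique (@norm_hausdorff C C) dl dn).
exact: normr_ge0.
Unshelve. all: by end_near. Qed.

End LimitInequality.

(** * Inner products *)

Section InnerProduct.
Variables (C : numFieldType) (theta : {rmorphism C -> C}).
Hypothesis thetaK : involutive theta.
Hypothesis thetaM : forall z, z * theta z = `|z| ^+ 2.
Variables (H : normedModType C) (ip : {dot H for theta}).
Hypothesis ip_norm : forall x : H, `|x| ^+ 2 = ip x x.

Lemma norm_conj (z : C) : `|theta z| = `|z|.
Proof.
have [->|z0] := eqVneq z 0; first by rewrite rmorph0.
by apply: (@mulfI _ `|z|); rewrite ?normr_eq0// -normrM thetaM expr2 normrM normr_id.
Qed.

(** Twice the real part of z, seen to be real as a combination of squared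
norms. *)
Lemma add_conj_real (z : C) : z + theta z \is Num.real.
Proof.
have -> : z + theta z = `|1 + z| ^+ 2 - 1 - `|z| ^+ 2.
  by rewrite -!thetaM rmorphD rmorph1; ring.
by rewrite !realB // ?real1 // ger0_real // exprn_ge0.
Qed.

Lemma ip_conj (x y : H) : theta (ip y x) = ip x y.
Proof. by rewrite [RHS]hermitian_subproof /= mul1r. Qed.

Lemma conj_sqr_normv (x : H) : theta (`|x| ^+ 2) = `|x| ^+ 2 :> C.
Proof. by rewrite ip_norm ip_conj. Qed.

Lemma sqr_norm_ip (x y : H) : `|ip x y| ^+ 2 = ip x y * ip y x.
Proof. by rewrite -thetaM ip_conj. Qed.

Lemma ipZl a (x y : H) : ip (a *: x) y = a * ip x y.
Proof. by rewrite linearZl_LR. Qed.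

Lemma ipZr a (x y : H) : ip x (a *: y) = theta a * ip x y.
Proof. by rewrite linearZr_LR. Qed.

Lemma sqr_normD (x y : H) : `|x + y| ^+ 2 = `|x| ^+ 2 + `|y| ^+ 2 + (ip x y + ip y x).
Proof. by rewrite !ip_norm linearDl !linearDr /=; ring. Qed.

Lemma sqr_normB (x y : H) : `|x - y| ^+ 2 = `|x| ^+ 2 + `|y| ^+ 2 - (ip x y + ip y x).
Proof. by rewrite !ip_norm linearBl !linearBr /=; ring. Qed.

Lemma parallelogram (x y : H) :
  `|x + y| ^+ 2 + `|x - y| ^+ 2 = 2 * (`|x| ^+ 2 + `|y| ^+ 2).
Proof. by rewrite sqr_normD sqr_normB; ring. Qed.

Lemma cauchy_schwarz (x y : H) : `|ip x y| <= `|x| * `|y|.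
Proof.
have [->|y0] := eqVneq y 0; first by rewrite linear0r normr0 mulr_ge0.
have n0 : 0 < `|y| ^+ 2 by rewrite exprn_gt0 // normr_gt0.
rewrite -(@ler_pXn2r _ 2) ?nnegrE ?mulr_ge0 // exprMn.
rewrite -subr_ge0 -(pmulr_rge0 _ n0).
(* n x - <x, y> y, with n = |y|^2, is n times the part of x orthogonal to y. *)
have -> : `|y| ^+ 2 * (`|x| ^+ 2 * `|y| ^+ 2 - `|ip x y| ^+ 2) =
    `|(`|y| ^+ 2) *: x - ip x y *: y| ^+ 2.
  rewrite sqr_norm_ip sqr_normB !normrZ !ipZl !ipZr ip_conj conj_sqr_normv.
  rewrite !exprMn sqr_norm_ip ger0_norm ?exprn_ge0 //.
  by ring.
by rewrite exprn_ge0.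
Qed.

Lemma ip_cvgl (T : Type) (F : set_system T) {FF : Filter F} (u : T -> H) l y :
  u @ F --> l -> (fun t => ip (u t) y) @ F --> ip l y.
Proof.
move=> /cvgrPdist_lt ul; apply/cvgrPdist_lt => e e0.
have p : 0 < `|y| + 1 by rewrite ltr_wpDl.
near=> t; rewrite -linearBl /=; apply: le_lt_trans (cauchy_schwarz _ _) _.
apply: (@le_lt_trans _ _ (`|l - u t| * (`|y| + 1))).
  by rewrite ler_wpM2l // lerDl.
rewrite -ltr_pdivlMr //; near: t; apply: ul; exact: divr_gt0.
Unshelve. all: by end_near. Qed.

Lemma ip_cvgr (T : Type) (F : set_system T) {FF : Filter F} (u : T -> H) l y :
  u @ F --> l -> (fun t => ip y (u t)) @ F --> ip y l.
Proof.
move=> /(ip_cvgl (y := y)) /cvgrPdist_lt ul; apply/cvgrPdist_lt => e /ul.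
apply: filterS => t; rewrite -[ip y l]ip_conj -[ip y (u t)]ip_conj.
by rewrite -rmorphB norm_conj.
Qed.

End InnerProduct.

(** * Riesz representation and adjoints *)

Section Riesz.
Variables (C : numFieldType) (theta : {rmorphism C -> C}).
Hypothesis thetaK : involutive theta.
Hypothesis thetaM : forall z, z * theta z = `|z| ^+ 2.
Hypothesis Csup : real_sup_complete C.
Variables (H : completeNormedModType C) (ip : {dot H for theta}).
Hypothesis ip_norm : forall x : H, `|x| ^+ 2 = ip x x.

Lemma real_inf_approx (T : Type) (t0 : T) (q : T -> C) (b : C) :
  (forall t, q t \is Num.real) -> (forall t, b <= q t) ->
  exists m, (forall t, m <= q t) /\ forall e : C, 0 < e -> exists t, q t < m + e.
Proof.
move=> qr bq.
have [|_ [t _ <-]||s [sub slub]] := Csup (A := [set - q t | t in setT]).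
- by exists (- q t0), t0.
- by rewrite /= realN; exact: qr.
- by exists (- b) => _ [t _ <-]; rewrite lerN2; exact: bq.
have sq t : - q t <= s by apply: sub; exists t.
have sr : s \is Num.real by rewrite -(ler_real (sq t0)) realN.
exists (- s); split=> [t|e e0]; first by rewrite lerNl.
apply: contrapT => nex.
suff : s <= s - e by rewrite lerDl oppr_ge0 => /(lt_le_trans e0); rewrite ltxx.
apply: slub => _ [t _ <-]; rewrite lerNl opprB.
rewrite real_leNgt ?qr ?realB ?(gtr0_real e0) //.
by apply/negP => qt; apply: nex; exists t; rewrite addrC.
Qed.

(** The representing vector is the minimizer of the energy
q x = |x|^2 - 2 Re (phi x): at the minimum, the first variation
<h, x> - phi h vanishes in every direction h. Near-minimizers form a Cauchy
filter by the parallelogram law. *)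
Lemma riesz (phi : H -> C) (M : C) :
  scalar phi -> (forall x, `|phi x| <= M * `|x|) ->
  exists z, forall x, phi x = ip x z.
Proof.
move=> phiP phiM.
have phiD x y : phi (x + y) = phi x + phi y.
  by rewrite -[x in LHS]scale1r phiP /= mul1r.
have phi0 : phi 0 = 0.
  by apply: (addrI (phi 0)); rewrite -phiD !addr0.
have phiZ a x : phi (a *: x) = a * phi x.
  by rewrite -[a *: x]addr0 phiP /= phi0 addr0.
pose q x := `|x| ^+ 2 - (phi x + theta (phi x)).
have qr x : q x \is Num.real.
  by rewrite realB // ?(add_conj_real thetaM) // ger0_real // exprn_ge0.
have qlow x : - `|M| ^+ 2 <= q x.
  have phiM' : `|phi x| <= `|M| * `|x|.
    have := phiM x; rewrite -[M * _]ger0_norm; last exact: le_trans (phiM x).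
    by rewrite normrM normr_id.
  have : phi x + theta (phi x) <= `|M| * `|x| + `|M| * `|x|.
    apply: le_trans (real_ler_norm (add_conj_real thetaM _)) _.
    by apply: le_trans (ler_normD _ _) _; rewrite (norm_conj thetaM) lerD.
  move=> h; rewrite /q -subr_ge0 opprK -addrA.
  apply: (@le_trans _ _ ((`|x| - `|M|) ^+ 2)).
    by rewrite real_exprn_even_ge0 // realB // normr_real.
  rewrite -subr_ge0; move: h; rewrite -subr_ge0; congr (_ <= _); ring.
have [m [mq qm]] := real_inf_approx 0 qr qlow.
pose B e := [set x | q x < m + e].
pose G := filter_from [set e : C | 0 < e] B.
have FG : ProperFilter G.
  apply: filter_from_proper; last by move=> e /qm.
  apply: filter_from_filter; first by exists 1; rewrite /= ltr01.
  move=> e1 e2 /= e10 e20; exists (Num.min e1 e2).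
    by rewrite /Order.min; case: ifP.
  have e12 : e1 >=< e2 by apply: real_comparable; exact: gtr0_real.
  have [l1 l2] : Num.min e1 e2 <= e1 /\ Num.min e1 e2 <= e2.
    by rewrite !comparable_ge_min // !lexx orbT.
  by move=> x qx; split; apply: lt_le_trans qx _; rewrite lerD2l.
(* The midpoint has energy at least m. *)
have near_min e x y : q x < m + e -> q y < m + e -> `|x - y| ^+ 2 < 4 * e.
  move=> qx qy.
  have mz := mq (2^-1 *: (x + y)).
  have -> : `|x - y| ^+ 2 = 2 * (q x + q y - 2 * q (2^-1 *: (x + y))).
    have := parallelogram ip_norm x y.
    move=> /(canRL (addKr _)) ->; rewrite /q !phiZ !phiD normrZ.
    rewrite ger0_norm ?invr_ge0 // !rmorphM !rmorphD fmorphV /= ?rmorph_nat.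
    by field.
  apply: (@lt_le_trans _ _ (2 * ((m + e) + (m + e) - 2 * q (2^-1 *: (x + y))))).
    by rewrite ltr_pM2l // ltrD2r ltrD.
  rewrite -subr_ge0; have : 0 <= 4 * (q (2^-1 *: (x + y)) - m).
    by rewrite mulr_ge0 // subr_ge0.
  by congr (_ <= _); ring.
have cG : cvg G.
  apply: cauchy_cvg; apply: cauchy_exP => e e0.
  have e4 : 0 < e ^+ 2 / 4 by rewrite divr_gt0 // exprn_gt0.
  have [x qx] := qm _ e4; exists x; exists (e ^+ 2 / 4) => // y qy.
  rewrite -ball_normE /=.
  rewrite -(@ltr_pXn2r _ 2) ?nnegrE ?(ltW e0) //.
  by have := near_min _ _ _ qx qy; rewrite mulrC divfK.
exists (lim G) => h; apply/esym.
(* d x is the first variation of q at x in the direction h. *)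
pose d x := ip h x - phi h.
have dB e x : B e x -> `|d x| ^+ 2 <= e * (`|h| ^+ 2 + 1).
  move=> qx; pose s : C := (`|h| ^+ 2 + 1)^-1.
  have h1 : 0 < `|h| ^+ 2 + 1 by rewrite ltr_wpDl // exprn_ge0.
  have s0 : 0 < s by rewrite invr_gt0.
  have ths : theta s = s.
    by rewrite /s fmorphV rmorphD rmorph1 (conj_sqr_normv ip_norm).
  (* Moving along t h lowers the energy by at least s |d x|^2. *)
  pose t := - s * theta (d x).
  have qt : q (x + t *: h) = q x - 2 * s * `|d x| ^+ 2
      + s ^+ 2 * `|d x| ^+ 2 * `|h| ^+ 2.
    rewrite /q (sqr_normD ip_norm) phiD phiZ normrZ exprMn ipZl ipZr !rmorphD.
    have -> : `|t| ^+ 2 = s ^+ 2 * `|d x| ^+ 2.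
      by rewrite /t normrM normrN exprMn (norm_conj thetaM) (gtr0_norm s0).
    rewrite -(thetaM (d x)) /t !rmorphM rmorphN ths thetaK /d rmorphB (ip_conj ip x h).
    ring.
  have := mq (x + t *: h); rewrite qt => mx.
  rewrite -ler_pdivrMr // -/s.
  have sd : s ^+ 2 * `|d x| ^+ 2 * `|h| ^+ 2 <= s * `|d x| ^+ 2.
    have -> : s ^+ 2 * `|d x| ^+ 2 * `|h| ^+ 2 = s * `|d x| ^+ 2 * (s * `|h| ^+ 2).
      by ring.
    rewrite ler_piMr // ?mulr_ge0 ?exprn_ge0 ?(ltW s0) //.
    by rewrite mulrC ler_pdivrMr // mul1r lerDl.
  rewrite mulrC.
  rewrite -subr_ge0 in mx; rewrite -subr_ge0 in sd.
  have qx' : 0 <= m + e - q x by rewrite subr_ge0 ltW.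
  rewrite -subr_ge0; have := addr_ge0 (addr_ge0 mx sd) qx'.
  by congr (_ <= _); ring.
have dG : d @ G --> ip h (lim G) - phi h.
  apply: (@cvgB C C H G _ _ (fun=> phi h) _ _ _ (cvg_cst _)).
  exact: (@ip_cvgr _ _ thetaM _ _ ip_norm _ _ _ id _ h cG).
have d0 : d @ G --> (0 : C).
  apply/cvgrPdist_lt => e e0.
  have h1 : 0 < `|h| ^+ 2 + 1 by rewrite ltr_wpDl // exprn_ge0.
  exists (e ^+ 2 / (2 * (`|h| ^+ 2 + 1))).
    by rewrite /= divr_gt0 ?exprn_gt0 // mulr_gt0.
  move=> x /dB dx; rewrite /= sub0r normrN.
  rewrite -(@ltr_pXn2r _ 2) ?nnegrE ?(ltW e0) //.
  apply: le_lt_trans dx _.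
  rewrite invfM mulrA divfK ?gt_eqF //.
  by rewrite ltr_pdivrMr // ltr_pMr ?exprn_gt0 // ltr1n.
by apply/eqP; rewrite -subr_eq0; apply/eqP; exact: (cvg_unique (@norm_hausdorff C C) dG d0).
Qed.

End Riesz.

(** * Unordered sums *)

Section PartialSums.
Variables (I : choiceType) (C : numFieldType).
#[local] Existing Instance totally_filter.

Lemma near_totally_supset (A : {fset I}) : \forall B \near totally, (A `<=` B)%fset.
Proof. by exists A. Qed.

Lemma eq_partial_sum (V : zmodType) (x y : I -> V) :
  x =1 y -> partial_sum x =1 partial_sum y.
Proof. by move=> xy A; apply: eq_bigr. Qed.

Lemma partial_sumD (V : zmodType) (x y : I -> V) A :
  partial_sum (fun i => x i + y i) A = partial_sum x A + partial_sum y A.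
Proof. exact: big_split. Qed.

(** Writing the increment as a sum over B with the terms of A zeroed lets bounds
on partial sums of arbitrary coefficients apply to it. *)
Lemma partial_sum_diff (V : zmodType) (x : I -> V) (A B : {fset I}) : (A `<=` B)%fset ->
  partial_sum x B - partial_sum x A =
    partial_sum (fun i => if i \in A then 0 else x i) B.
Proof.
move=> AB; apply/eqP; rewrite subr_eq; apply/eqP.
have -> : partial_sum x A = partial_sum (fun i => if i \in A then x i else 0) B.
  rewrite /partial_sum -(big_seq_fsetE _ A xpredT x).
  rewrite -(big_seq_fsetE _ B xpredT (fun i => if i \in A then x i else 0)) /=.
  rewrite [LHS](eq_big_seq (fun i => if i \in A then x i else 0)); last first.
    by move=> i ->.
  by apply: big_fset_incl => // i _ /negbTE ->.
rewrite -partial_sumD; apply: eq_partial_sum => i.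
by case: ifP; rewrite ?add0r ?addr0.
Qed.

Lemma partial_sum_le_lim (x : I -> C) (l : C) (A : {fset I}) :
  (forall i, 0 <= x i) -> partial_sum x @ totally --> l -> partial_sum x A <= l.
Proof.
move=> x0 xl; rewrite -lerN2.
apply: (lim_le_cst (F := totally) (u := fun B => - partial_sum x B)).
  exact: cvgN xl.
apply: filterS (near_totally_supset A) => B AB.
rewrite lerN2 -subr_ge0 partial_sum_diff //.
by apply: sumr_ge0 => i _; case: ifP.
Qed.

End PartialSums.

(** Cauchy-Schwarz in the form used to dualize a Bessel bound. Over a partially
ordered field it follows without square roots from
0 <= sum (r a_j - b_j)^2, which bounds 2 r V by r^2 (sum a_j^2) + r V. *)
Lemma le_sum_sqr_of_cross (C : numFieldType) (J : finType) (a b : J -> C) (r V : C) :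
  0 <= r -> (forall j, 0 <= a j) -> (forall j, 0 <= b j) ->
  V <= \sum_j a j * b j -> \sum_j b j ^+ 2 <= r * V ->
  V <= r * \sum_j a j ^+ 2.
Proof.
move=> r0 a0 b0 Vab bV.
move: r0; rewrite le_eqVlt => /predU1P[r0|r0].
  (* For r = 0 no division by r is possible, but all b_j vanish. *)
  rewrite -r0 mul0r in bV; rewrite -r0 mul0r.
  have b20 : \sum_j b j ^+ 2 = 0.
    by apply/eqP; rewrite eq_le bV sumr_ge0 // => j _; rewrite exprn_ge0.
  apply: le_trans Vab _; rewrite big1 // => j _.
  have /eqP := psumr_eq0P (fun i _ => exprn_ge0 2 (b0 i)) b20 (i := j) isT.
  by rewrite sqrf_eq0 => /eqP ->; rewrite mulr0.
have : 0 <= \sum_j (r * a j - b j) ^+ 2.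
  apply: sumr_ge0 => j _; rewrite real_exprn_even_ge0 // realB // ger0_real //.
  by rewrite mulr_ge0 // ltW.
have -> : \sum_j (r * a j - b j) ^+ 2 =
    r ^+ 2 * (\sum_j a j ^+ 2) - 2 * r * (\sum_j a j * b j) + \sum_j b j ^+ 2.
  rewrite !mulr_sumr -sumrB -big_split /=; apply: eq_bigr => j _; ring.
move=> h; rewrite -(ler_pM2l r0) -subr_ge0.
have h2 : 0 <= 2 * r * (\sum_j a j * b j - V).
  by rewrite mulr_ge0 ?subr_ge0 // mulr_ge0 // ltW.
rewrite -subr_ge0 in bV.
have := addr_ge0 (addr_ge0 h h2) bV; congr (_ <= _); ring.
Qed.

(** * Synthesis from square-summable coefficients *)

Section Synthesis.
Variables (C : numFieldType) (theta : {rmorphism C -> C}).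
Hypothesis thetaM : forall z, z * theta z = `|z| ^+ 2.
Variables (H : completeNormedModType C) (ip : {dot H for theta}).
Hypothesis ip_norm : forall x : H, `|x| ^+ 2 = ip x x.
Variables (I : choiceType) (F : I -> H) (N : C).
Hypothesis N_ge0 : 0 <= N.
Hypothesis bessel : forall v (A : {fset I}),
  partial_sum (fun i => `|ip v (F i)| ^+ 2) A <= N ^+ 2 * `|v| ^+ 2.
#[local] Existing Instance totally_filter.

(** The synthesis map is the adjoint of the analysis map v |-> (<v, f_i>)_i, so
it has the same norm bound N. *)
Lemma synthesis_le (c : I -> C) (A : {fset I}) :
  `|partial_sum (fun i => c i *: F i) A| ^+ 2 <=
    N ^+ 2 * partial_sum (fun i => `|c i| ^+ 2) A.
Proof.
set v := partial_sum _ A.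
apply: (@le_sum_sqr_of_cross _ _ _ (fun i => `|ip v (F (val i))|)) => //.
- by rewrite exprn_ge0.
- rewrite -[leLHS]ger0_norm ?exprn_ge0 // {1}ip_norm {1}/v linear_sumlz.
  apply: le_trans (ler_norm_sum _ _ _) _; apply: ler_sum => i _.
  by rewrite /= ipZl normrM -(ip_conj ip _ v) (norm_conj thetaM).
- exact: bessel.
Qed.

(** The increments of the synthesis are controlled by the tails of
sum |d_i|^2. The dominated coefficients c make the lemma apply to restrictions
of d to an index subset. *)
Lemma synthesis_cvg (c d : I -> C) (L : C) :
  partial_sum (fun i => `|d i| ^+ 2) @ totally --> L ->
  (forall i, `|c i| <= `|d i|) ->
  cvg (partial_sum (fun i => c i *: F i) @ totally).
Proof.
move=> dL cd; apply: cauchy_cvg; apply: cauchy_exP => e e0.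
(* N may vanish, hence N^2 + 1. *)
have p : 0 < N ^+ 2 + 1 by rewrite ltr_wpDl // exprn_ge0.
have e2 : 0 < e ^+ 2 / (N ^+ 2 + 1) by rewrite divr_gt0 // exprn_gt0.
have [A _ HA] := (cvgrPdist_lt _ _).1 dL _ e2.
exists (partial_sum (fun i => c i *: F i) A); exists A => // B /= AB.
rewrite -ball_normE /= distrC partial_sum_diff //.
rewrite -(@ltr_pXn2r _ 2) ?nnegrE ?(ltW e0) //.
have -> : partial_sum (fun i => if i \in A then 0 else c i *: F i) B =
    partial_sum (fun i => (if i \in A then 0 else c i) *: F i) B.
  by apply: eq_partial_sum => i; case: ifP => //; rewrite scale0r.
apply: le_lt_trans (synthesis_le _ _) _.
have dge0 i : 0 <= `|d i| ^+ 2 by rewrite exprn_ge0.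
have dBA : partial_sum (fun i => `|if i \in A then 0 else c i| ^+ 2) B <=
    L - partial_sum (fun i => `|d i| ^+ 2) A.
  apply: (@le_trans _ _ (partial_sum (fun i => if i \in A then 0 else `|d i| ^+ 2) B)).
    apply: ler_sum => i _; case: ifP => _; first by rewrite normr0 expr0n.
    by rewrite ler_pXn2r ?nnegrE.
  by rewrite -partial_sum_diff // lerD2r; exact: partial_sum_le_lim.
have := HA A (fsubset_refl A); rewrite /= ger0_norm; last first.
  by rewrite subr_ge0; exact: partial_sum_le_lim.
rewrite ltr_pdivlMr // mulrC => h.
apply: le_lt_trans h; apply: ler_pM => //; first by rewrite exprn_ge0.
  by apply: sumr_ge0 => i _; rewrite exprn_ge0.
by rewrite lerDl.
Qed.

End Synthesis.

(** * Operator norm and adjoint *)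

Section Operator.
Variables (C : numFieldType) (theta : {rmorphism C -> C}).
Hypothesis thetaK : involutive theta.
Hypothesis thetaM : forall z, z * theta z = `|z| ^+ 2.
Hypothesis Csup : real_sup_complete C.
Variables (H : completeNormedModType C) (ip : {dot H for theta}).
Hypothesis ip_norm : forall x : H, `|x| ^+ 2 = ip x x.
Variables (K : {linear H -> H}).
Hypothesis K_bounded : bounded_operator K.

Lemma adjointE x y : ip (K x) y = ip x (adjoint ip K y).
Proof.
suff : exists z, forall x, ip (K x) y = ip x z.
  by move=> /(xgetPex (0 : H)); apply.
have [M KM] := K_bounded.
apply: (riesz thetaK thetaM Csup ip_norm (M := M * `|y|)).
  by move=> a u v; rewrite linearP linearDl /= ipZl.
move=> u; apply: le_trans (cauchy_schwarz thetaM ip_norm _ _) _.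
by rewrite mulrAC ler_wpM2r.
Qed.

Lemma ip_injr (y z : H) : (forall x, ip x y = ip x z) -> y = z.
Proof.
move=> yz; apply/eqP; rewrite -subr_eq0 -normr_eq0 -sqrf_eq0 ip_norm linearBr /=.
by rewrite yz subrr.
Qed.

Lemma adjointD x y : adjoint ip K (x + y) = adjoint ip K x + adjoint ip K y.
Proof.
by apply: ip_injr => z; rewrite -adjointE !linearDr /= !adjointE.
Qed.

Lemma op_norm_sup : supremums [set `|K x| | x in [set x : H | `|x| <= 1]] (op_norm K).
Proof.
have K0 : [set `|K x| | x in [set x : H | `|x| <= 1]] 0.
  by exists 0; rewrite /= ?linear0 normr0.
rewrite /op_norm /supremum ifF; last by apply/negbTE/set0P; exists 0.
apply: xgetPex; apply: Csup; first by exists 0.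
  by move=> _ [x _ <-]; rewrite /= normr_real.
(* M is an arbitrary scalar when H is trivial, hence |M|. *)
have [M KM] := K_bounded; exists `|M| => _ [x /= x1 <-].
apply: (@le_trans _ _ (`|M| * `|x|)); last by rewrite ler_piMr.
have := KM x; rewrite -[M * _]ger0_norm; last exact: le_trans (KM x).
by rewrite normrM normr_id.
Qed.

Lemma op_norm_ge0 : 0 <= op_norm K.
Proof.
by have [+ _] := op_norm_sup; apply; exists 0; rewrite /= ?linear0 normr0.
Qed.

Lemma op_normP x : `|K x| <= op_norm K * `|x|.
Proof.
have [->|x0] := eqVneq x 0; first by rewrite linear0 !normr0 mulr0.
have nx : 0 < `|x| by rewrite normr_gt0.
rewrite -ler_pdivrMr //; have [+ _] := op_norm_sup; apply.
exists (`|x|^-1 *: x); last by rewrite linearZ normrZ normfV normr_id mulrC.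
by rewrite /= normrZ normfV normr_id mulVf ?normr_eq0.
Qed.

Lemma norm_adjoint_le y : `|adjoint ip K y| <= op_norm K * `|y|.
Proof.
set z := adjoint ip K y.
have [->|z0] := eqVneq z 0; first by rewrite normr0 mulr_ge0 ?op_norm_ge0.
have nz : 0 < `|z| by rewrite normr_gt0.
rewrite -(ler_pM2l nz) -expr2 ip_norm -adjointE.
rewrite -[leLHS]ger0_norm; last by rewrite adjointE -ip_norm exprn_ge0.
apply: le_trans (cauchy_schwarz thetaM ip_norm _ _) _.
by rewrite mulrA [_ * op_norm K]mulrC ler_wpM2r // op_normP.
Qed.

End Operator.

(** * Parseval K-frames *)

Section Frame.
Variables (C : numFieldType) (theta : {rmorphism C -> C}).
Hypothesis thetaK : involutive theta.
Hypothesis thetaM : forall z, z * theta z = `|z| ^+ 2.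
Hypothesis Csup : real_sup_complete C.
Variables (H : completeNormedModType C) (ip : {dot H for theta}).
Hypothesis ip_norm : forall x : H, `|x| ^+ 2 = ip x x.
Variables (K : {linear H -> H}).
Hypothesis K_bounded : bounded_operator K.
Variables (I : choiceType) (F : I -> H).
Hypothesis F_frame : parseval_Kframe ip K F.
#[local] Existing Instance totally_filter.

Let N := op_norm K.
Let adj := adjoint ip K.
Let N_ge0 : 0 <= N := op_norm_ge0 Csup K_bounded.

Lemma frame_bessel v (A : {fset I}) :
  partial_sum (fun i => `|ip v (F i)| ^+ 2) A <= N ^+ 2 * `|v| ^+ 2.
Proof.
apply: (@le_trans _ _ (`|adj v| ^+ 2)).
  by apply: (partial_sum_le_lim A _ (@F_frame v)) => i; rewrite exprn_ge0.
rewrite -exprMn ler_pXn2r ?nnegrE ?mulr_ge0 //.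
exact: norm_adjoint_le.
Qed.

(** The two real quadratic forms v |-> <S v, v> and |K^* v|^2 agree, where S is
the frame operator. Polarizing between f and g, at the level of finite sums
before passing to the limit, gives Re <D, g> = 0 for D = S f - K K^* f and all
g; then take g = D. *)
Lemma frame_reconstruction (f l : H) :
  partial_sum (fun i => ip f (F i) *: F i) @ totally --> l -> l = K (adj f).
Proof.
move=> Sl.
have key g : ip l g + ip g l = ip (K (adj f)) g + ip g (K (adj f)).
  have cl : (fun A => partial_sum (fun i => `|ip (f + g) (F i)| ^+ 2) A -
      partial_sum (fun i => `|ip f (F i)| ^+ 2) A -
      partial_sum (fun i => `|ip g (F i)| ^+ 2) A) @ totally --> ip l g + ip g l.
    have -> : (fun A => partial_sum (fun i => `|ip (f + g) (F i)| ^+ 2) A -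
        partial_sum (fun i => `|ip f (F i)| ^+ 2) A -
        partial_sum (fun i => `|ip g (F i)| ^+ 2) A) =
        (fun A => ip (partial_sum (fun i => ip f (F i) *: F i) A) g) \+
        (fun A => ip g (partial_sum (fun i => ip f (F i) *: F i) A)).
      apply/funext => A; rewrite /partial_sum /= linear_sumlz linear_sumr.
      rewrite -!sumrB -big_split /=; apply: eq_bigr => i _.
      rewrite ipZl ipZr linearDl /= -!thetaM rmorphD !(ip_conj ip); ring.
    apply: cvgD; first exact: (ip_cvgl thetaM ip_norm Sl).
    exact: (ip_cvgr thetaM ip_norm Sl).
  have cr := cvgB (cvgB (@F_frame (f + g)) (@F_frame f)) (@F_frame g).
  rewrite (cvg_unique (@norm_hausdorff C C) cl (cr _ _)).
  rewrite (adjointD thetaK thetaM Csup ip_norm K_bounded) (sqr_normD ip_norm).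
  rewrite (adjointE thetaK thetaM Csup ip_norm K_bounded).
  rewrite -[ip g (K _)](ip_conj ip) (adjointE thetaK thetaM Csup ip_norm K_bounded).
  rewrite (ip_conj ip) /adj; ring.
have [D defD] : exists D, D = l - K (adj f) by eexists.
have : ip D D + ip D D = 0.
  rewrite {1 4}defD linearBl linearBr /= addrACA -opprD.
  by rewrite key subrr.
move/eqP; rewrite -ip_norm -mulr2n mulrn_eq0 /= sqrf_eq0 normr_eq0 defD subr_eq0.
by move/eqP.
Qed.

Lemma patch_scale (J : set I) (c : I -> C) :
  patch (fun=> 0) J (fun i => c i *: F i) =
    (fun i => patch (fun=> 0) J c i *: F i).
Proof. by apply/funext => i; rewrite /patch; case: ifP; rewrite ?scale0r. Qed.

Lemma summable_on_frame (J : set I) f : summable_on J (fun i => ip f (F i) *: F i).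
Proof.
rewrite /summable_on patch_scale.
apply: (synthesis_cvg thetaM ip_norm N_ge0 frame_bessel (@F_frame f)) => i.
by rewrite /patch; case: ifP; rewrite ?normr0.
Qed.

Lemma sum_on_cvg (J : set I) f :
  partial_sum (patch (fun=> 0) J (fun i => ip f (F i) *: F i)) @ totally -->
    sum_on J (fun i => ip f (F i) *: F i).
Proof. exact: summable_on_frame. Qed.

Lemma sum_on_splitE (J : set I) f :
  sum_on J (fun i => ip f (F i) *: F i) + sum_on (~` J) (fun i => ip f (F i) *: F i)
    = K (adj f).
Proof.
apply: frame_reconstruction.
set x := fun i => _; have -> : partial_sum x =
    partial_sum (patch (fun=> 0) J x) \+ partial_sum (patch (fun=> 0) (~` J) x).
  apply/funext => A; rewrite /= -partial_sumD; apply: eq_partial_sum => i.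
  by rewrite /patch in_setC; case: (i \in J); rewrite ?addr0 ?add0r.
exact: (cvgD (@sum_on_cvg J f) (@sum_on_cvg (~` J) f)).
Qed.

(** Each finite index set splits along J, so the two synthesis bounds add up to
N^2 times a partial sum of the whole series sum |<f, f_i>|^2. *)
Lemma sum_on_sqr_le (J : set I) f :
  `|sum_on J (fun i => ip f (F i) *: F i)| ^+ 2 +
  `|sum_on (~` J) (fun i => ip f (F i) *: F i)| ^+ 2 <= N ^+ 2 * `|adj f| ^+ 2.
Proof.
pose S J' A := partial_sum (patch (fun=> 0) J' (fun i => ip f (F i) *: F i)) A.
have sqr_cvg J' : (fun A => `|S J' A| ^+ 2) @ totally -->
    `|sum_on J' (fun i => ip f (F i) *: F i)| ^+ 2.
  have h : (fun A => `|S J' A|) @ totally -->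
      `|sum_on J' (fun i => ip f (F i) *: F i)|.
    exact: cvg_norm (@sum_on_cvg J' f).
  have hh := cvgM h h; exact: hh.
apply: (lim_le_cst (F := totally) (u := fun A => `|S J A| ^+ 2 + `|S (~` J) A| ^+ 2)).
  exact: (cvgD (sqr_cvg J) (sqr_cvg (~` J))).
apply: nearW => A.
have bnd J' : `|S J' A| ^+ 2 <= N ^+ 2 *
    partial_sum (fun i => `|patch (fun=> 0) J' (fun i => ip f (F i)) i| ^+ 2) A.
  rewrite /S patch_scale.
  exact: (synthesis_le thetaM ip_norm N_ge0 frame_bessel
    (patch (fun=> 0) J' (fun i => ip f (F i))) A).
apply: le_trans (lerD (bnd J) (bnd (~` J))) _.
rewrite -mulrDr -partial_sumD ler_wpM2l ?exprn_ge0 //.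
apply: le_trans (partial_sum_le_lim A _ (@F_frame f)); last first.
  by move=> i; rewrite exprn_ge0.
apply: ler_sum => i _; rewrite /patch in_setC.
by case: (_ \in J); rewrite /= normr0 expr0n ?addr0 ?add0r.
Qed.

Lemma frame_split_bounds (J : set I) f :
  2^-1 * `|K (adj f)| ^+ 2
    <= `|sum_on J (fun i => ip f (F i) *: F i)| ^+ 2
       + `|sum_on (~` J) (fun i => ip f (F i) *: F i)| ^+ 2
    <= 2 * N ^+ 2 * `|adj f| ^+ 2 - 2^-1 * `|K (adj f)| ^+ 2.
Proof.
apply/andP; split.
  rewrite -(sum_on_splitE J f) ler_pdivrMl // -(parallelogram ip_norm).
  by rewrite lerDl exprn_ge0.
apply: le_trans (sum_on_sqr_le J f) _.
have KN : `|K (adj f)| ^+ 2 <= N ^+ 2 * `|adj f| ^+ 2.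
  by rewrite -exprMn ler_pXn2r ?nnegrE ?mulr_ge0 //; exact: op_normP.
rewrite lerBrDr -mulrA mulrDl mul1r lerD2l.
rewrite ler_pdivrMl //; apply: le_trans KN _.
by rewrite ler_peMl ?ler1n // mulr_ge0 // exprn_ge0.
Qed.

End Frame.

(** * The two-sided estimate *)

Theorem corollary3p4 (R : realType) (k : scalar_kind)
    (H : completeNormedModType (scalar_field R k))
    (ip : {dot H for scalar_conj R k})
    (ip_norm : forall x : H, `|x| ^+ 2 = ip x x)
    (H_separable : separable_space H)
    (K : {linear H -> H}) (K_bounded : bounded_operator K)
    (I : countType) (F : I -> H) (F_frame : parseval_Kframe ip K F)
    (J : set I) (f : H) :
  let x := fun i => ip f (F i) *: F i in
  [/\ summable_on J x, summable_on (~` J) x &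
      2^-1 * `|K (adjoint ip K f)| ^+ 2
        <= `|sum_on J x| ^+ 2 + `|sum_on (~` J) x| ^+ 2
        <= 2 * op_norm K ^+ 2 * `|adjoint ip K f| ^+ 2
           - 2^-1 * `|K (adjoint ip K f)| ^+ 2].
Proof.
move=> x; split; first 2 last.
- exact: (frame_split_bounds (@scalar_conjK R k) (@mul_scalar_conj R k)
    (@scalar_field_real_sup R k) ip_norm K_bounded F_frame).
- exact: (summable_on_frame (@scalar_conjK R k) (@mul_scalar_conj R k)
    (@scalar_field_real_sup R k) ip_norm K_bounded F_frame).
- exact: (summable_on_frame (@scalar_conjK R k) (@mul_scalar_conj R k)
    (@scalar_field_real_sup R k) ip_norm K_bounded F_frame).
Qed.
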